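(* For every fixed $\alpha\in(0,1)$ and every integer $k\geq 3$, the smallest limit point of the $\alpha$-spectral radii of connected $k$-uniform hypergraphs, i.e. the smallest limit point of the set $\{\rho_\alpha(H): H \text{ a connected } k\text{-uniform hypergraph}\}\subset\mathbb R$, is $\lambda_k(\alpha)$.
   Context: A hypergraph $H$ consists of a finite nonempty vertex set $V(H)$ and a set $E(H)$ of nonempty subsets of $V(H)$ (edges); it is $k$-uniform if every edge has exactly $k$ elements. All hypergraphs are connected (in the sense of vertex--edge walks), uniform and have at least one edge. $d_i$ denotes the degree of vertex $i$, the number of edges containing it. For $k\ge3$, $0\le\alpha<1$ and a $k$-uniform $H$ with $V(H)=[n]$, let $\mathcal A(H)$ be the order-$k$, dimension-$n$ tensor whose $(i_1,\dots,i_k)$ entry is $\frac1{(k-1)!}$ if $\{i_1,\dots,i_k\}\in E(H)$ and $0$ otherwise, let $\mathcal D(H)$ be the diagonal tensor of vertex degrees, and $\mathcal A_\alpha(H)=\alpha\mathcal D(H)+(1-\alpha)\mathcal A(H)$. A number $\lambda\in\mathbb C$ is an eigenvalue of $\mathcal A_\alpha(H)$ if there is $0\ne x\in\mathbb C^n$ with $\alpha d_ix_i^{k-1}+(1-\alpha)\sum_{e\ni i}\prod_{j\in e\setminus\{i\}}x_j=\lambda x_i^{k-1}$ for all $i\in[n]$. The $\alpha$-spectral radius $\rho_\alpha(H)$ is the maximum of $|\lambda|$ over all eigenvalues $\lambda$ of $\mathcal A_\alpha(H)$. The loose cycle $C_m^k$ ($m\ge3$) is obtained from the ordinary cycle with $m$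 edges by adding $k-2$ new vertices to each edge, distinct new vertices being used for distinct edges; $C_2^k$ is the hypergraph consisting of two distinct $k$-edges meeting in exactly two vertices. All $C_m^k$, $m\ge2$, have the same $\alpha$-spectral radius, denoted $\lambda_k(\alpha)$; it is the largest root of $\left(\frac x2-\alpha\right)^2(x-\alpha)^{k-2}-(1-\alpha)^k=0$. A real number $\mu$ is a limit point of the $\alpha$-spectral radii if there is a sequence of connected $k$-uniform hypergraphs $H_1,H_2,\dots$ with pairwise distinct values $\rho_\alpha(H_i)$ converging to $\mu$. *)

(* Defs.v *)
From HB Require Import structures.
From mathcomp Require Import all_boot all_order all_algebra.
From mathcomp Require Import all_classical all_reals all_analysis.
From mathcomp Require Import complex.

Set Implicit Arguments.
Unset Strict Implicit.
Unset Printing Implicit Defensive.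

Import Order.TTheory GRing.Theory Num.Theory.
Import numFieldNormedType.Exports.

Local Open Scope ring_scope.

Record hypergraph := Hypergraph {
  vertex :> finType;
  edges : {set {set vertex}};
  vertex_gt0 : (0 < #|vertex|)%N;
  edges_neq0 : finset.set0 \notin edges }.

Definition uniform (k : nat) (H : hypergraph) : Prop :=
  forall e, e \in edges H -> #|e| = k.

Definition adjacent (H : hypergraph) : rel H :=
  fun u v => [exists e in edges H, (u \in e) && (v \in e)].

Definition connected_hypergraph (H : hypergraph) : Prop :=
  forall u v : H, connect (@adjacent H) u v.

Definition connected_uniform (k : nat) (H : hypergraph) : Prop :=
  [/\ uniform k H, connected_hypergraph H & (0 < #|edges H|)%N].

Definition degree (H : hypergraph) (i : H) : nat :=
  #|[set e in edges H | i \in e]|.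

(* The i-th coordinate of the tensor equation A_alpha x^(k-1) = lambda x^[k-1];
   the (k-1)! orderings of e \ {i} cancel the entries 1/(k-1)! of the
   adjacency tensor. *)
Definition alpha_eigenvalue (R : realType) (k : nat) (alpha : R)
    (H : hypergraph) (lambda : R[i]) : Prop :=
  exists2 x : {ffun H -> R[i]}, x != 0 &
    forall i : H,
      (alpha%:C)%C * (degree i)%:R * x i ^+ k.-1
      + ((1 - alpha)%:C)%C *
          (\sum_(e in edges H | i \in e) \prod_(j in e :\ i) x j)
      = lambda * x i ^+ k.-1.

Definition is_alpha_spectral_radius (R : realType) (k : nat) (alpha : R)
    (H : hypergraph) (r : R) : Prop :=
  (exists2 lambda, alpha_eigenvalue k alpha H lambda & `|lambda| = (r%:C)%C)
  /\ (forall lambda, alpha_eigenvalue k alpha H lambda ->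
        `|lambda| <= (r%:C)%C).

Definition is_spectral_limit_point (R : realType) (k : nat) (alpha : R)
    (mu : R) : Prop :=
  exists (H : nat -> hypergraph) (r : R^nat),
    [/\ forall i, connected_uniform k (H i),
        forall i, is_alpha_spectral_radius k alpha (H i) (r i),
        injective r
      & (r @ \oo --> mu)%classic].

Definition is_smallest_spectral_limit_point (R : realType) (k : nat)
    (alpha : R) (mu : R) : Prop :=
  is_spectral_limit_point k alpha mu
  /\ (forall nu, is_spectral_limit_point k alpha nu -> mu <= nu).

(* [inl i] are the vertices of the ordinary cycle and [inr (i, _)] the k - 2
   new vertices of its i-th edge.  For m = 2 the two edges share exactly
   [inl 0] and [inl 1], and are distinct as soon as k >= 3. *)
Definition loose_cycle_vertex (k m : nat) : finType :=
  ('I_m + 'I_m * 'I_(k - 2))%type.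

Definition loose_cycle_edge (k m : nat) (i : 'I_m) :
    {set loose_cycle_vertex k m} :=
  inl i |: (inl (ordS i) |: [set inr (i, j) | j : 'I_(k - 2)]).

Definition loose_cycle_edges (k m : nat) : {set {set loose_cycle_vertex k m}} :=
  [set loose_cycle_edge k i | i : 'I_m].

Lemma loose_cycle_vertex_gt0 (k m : nat) (m_gt1 : (1 < m)%N) :
  (0 < #|loose_cycle_vertex k m|)%N.
Proof.
by apply/card_gt0P; exists (inl (Ordinal (ltnW m_gt1))).
Qed.

Lemma loose_cycle_edges_neq0 (k m : nat) :
  finset.set0 \notin loose_cycle_edges k m.
Proof.
apply/negP => /imsetP[i _ /setP/(_ (inl i))].
by rewrite !inE eqxx.
Qed.

Definition loose_cycle (k m : nat) (m_gt1 : (1 < m)%N) : hypergraph :=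
  Hypergraph (loose_cycle_vertex_gt0 k m_gt1) (loose_cycle_edges_neq0 k m).

(* lambda_k(alpha), the common alpha-spectral radius of all loose cycles *)
Definition is_lambda (R : realType) (k : nat) (alpha : R) (lambda : R) : Prop :=
  forall (m : nat) (m_gt1 : (1 < m)%N),
    is_alpha_spectral_radius k alpha (loose_cycle k m_gt1) lambda.

(* Main.v *)
(* By compactness, the maximum of the form
     F(x) = sum_e (alpha sum_(v in e) x_v^k + (1 - alpha) k prod_(v in e) x_v)
   over x >= 0 with sum x_v^k = 1 is the spectral radius.  Write lambda =
   2h + 2 alpha, where h^2 (2h + alpha)^(k-2) = (1 - alpha)^k.

   Lower bounds on the radius come from test vectors that take one value on a
   set meeting each chosen edge twice and another value on the rest of these
   edges; upper bounds come from AM-GM on each edge with weights whose product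
   is (1 - alpha)^k.  Both give lambda on loose cycles.  On loose paths a
   strictly concave profile makes the upper bound strict, and the lower bound
   tends to lambda with the length, so lambda is a limit point.

   If the radius is at most t < lambda, the degrees are bounded because
   alpha > 0, and so is the length of a geodesic, since a long one carries a
   test vector with value close to lambda.  Hence only finitely many connected
   hypergraphs occur up to relabelling, and no limit point lies below
   lambda. *)
Require Import Defs.
From mathcomp Require Import all_boot all_order all_algebra.
From mathcomp Require Import all_classical all_reals all_analysis.
From mathcomp Require Import complex ring lra zify.

Set Implicit Arguments.
Unset Strict Implicit.
Unset Printing Implicit Defensive.

Import Order.TTheory GRing.Theory Num.Theory.
Import numFieldNormedType.Exports.

Local Open Scope ring_scope.

(** * Roots, continuity and a one-variable minimum *)

Lemma nonneg_root (R : realType) (k : nat) (a : R) :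
  (0 < k)%N -> 0 <= a -> exists2 b, 0 <= b & b ^+ k = a.
Proof.
move=> k_gt0 a_ge0; exists (a `^ k%:R^-1); first exact: powR_ge0.
by rewrite -powR_mulrn ?powR_ge0// -powRrM mulVf ?powRr1// pnatr_eq0 -lt0n.
Qed.

Lemma prodr_continuous (R : realType) (T : topologicalType) (I : Type) (r : seq I)
    (P : pred I) (f : I -> T -> R) :
  (forall i, continuous (f i)) ->
  continuous (fun x => \prod_(i <- r | P i) f i x).
Proof. by move=> fc; apply: continuous_big => //; exact: mul_continuous. Qed.

Lemma sumr_continuous (R : realType) (T : topologicalType) (I : Type) (r : seq I)
    (P : pred I) (f : I -> T -> R) :
  (forall i, continuous (f i)) ->
  continuous (fun x => \sum_(i <- r | P i) f i x).
Proof. by move=> fc; apply: continuous_big => //; exact: add_continuous. Qed.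

Lemma exprX_continuous (R : realType) (T : topologicalType) (n : nat) (f : T -> R) :
  continuous f -> continuous (fun x => f x ^+ n).
Proof. by move=> fc x; exact: (cvg_comp _ _ (fc x) (@exprn_continuous R n (f x))). Qed.

(* Stationarity of [c s^k - k p s] at a minimum over [s >= 0], boundary
   included. *)
Lemma stationary_at_min (R : realType) (k : nat) (c p s0 : R) :
    (1 < k)%N -> 0 <= p -> 0 <= s0 ->
    (forall s, 0 <= s ->
       c * s0 ^+ k - k%:R * p * s0 <= c * s ^+ k - k%:R * p * s) ->
  c * s0 ^+ k.-1 = p.
Proof.
move=> k_gt1 p_ge0; rewrite le_eqVlt => /predU1P[<-|s0_gt0] min_s0.
  have k1_gt0 : (0 < k.-1)%N by case: (k) k_gt1 => [|[]].
  rewrite expr0n gtn_eqF// mulr0.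
  apply/eqP; rewrite eq_le p_ge0 /= leNgt; apply/negP => p_gt0.
  have c1_gt0 : 0 < `|c| + 1 by rewrite ltr_wpDl.
  (* In the boundary case minimality reads [k p s <= c s^k]. If [p > 0], dividing by this [s] in
     [(0,1]] gives [p <= |c| s], whereas [(|c| + 1) s <= p]. *)
  pose s := Num.min 1 (p / (`|c| + 1)).
  have s_gt0 : 0 < s by rewrite lt_min ltr01 divr_gt0.
  have s_le1 : s <= 1 by rewrite ge_min lexx.
  have := min_s0 s (ltW s_gt0).
  have sk : s ^+ k = s ^+ k.-2 * s * s.
    by rewrite -!exprSr; case: (k) k_gt1 => [|[]].
  rewrite expr0n gtn_eqF ?(ltnW k_gt1)// !mulr0 subr0 subr_ge0 sk mulrA ler_pM2r//.
  move=> le_p.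
  have {}le_p : p <= `|c| * s.
    apply: le_trans (le_trans le_p _); first by rewrite ler_peMl// ler1n ltnW.
    rewrite mulrA ler_pM2r//; apply: le_trans (ler_norm _) _.
    rewrite normrM (ger0_norm (exprn_ge0 _ (ltW s_gt0))) ler_piMr//.
    by rewrite exprn_ile1// ltW.
  have : `|c| * s < p.
    rewrite (@lt_le_trans _ _ ((`|c| + 1) * s))// ?ltr_pM2r ?ltrDl//.
    by rewrite mulrC -ler_pdivlMr// ge_min lexx orbT.
  by rewrite ltNge le_p.
pose f := c *: 'X^k - (k%:R * p) *: 'X.
have fE s : f.[s] = c * s ^+ k - k%:R * p * s by rewrite /f !hornerE.
have : is_derive s0 (1 : R) (horner f) 0.
  apply: (@derive1_at_min _ _ 0 (s0 + 1)).
  - by rewrite ltW// ltr_wpDr.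
  - by move=> t _; exact: derivable_horner.
  - by rewrite in_itv/= s0_gt0 ltrDl ltr01.
  - by move=> t; rewrite in_itv/= !fE => /andP[/ltW t_ge0 _]; exact: min_s0.
move=> d0; have := @derive_val _ _ _ _ _ _ _ d0.
rewrite (@derive_val _ _ _ _ _ _ _ (is_derive_poly f s0)) /f derivB.
rewrite !derivZ derivXn derivX hornerD hornerN !hornerZ hornerMn hornerXn hornerC.
have k_neq0 : k%:R != 0 :> R by rewrite pnatr_eq0 -lt0n ltnW.
move=> /eqP; rewrite subr_eq0 => /eqP E.
by apply: (mulfI k_neq0); move: E; rewrite mulr1 => <-; rewrite mulrCA mulr_natl.
Qed.

(** * The form [F] and its maximum on the nonnegative unit sphere *)

Section Form.
Variables (R : realType) (k : nat) (alpha : R).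

(** This is the polynomial [A_alpha(H) x^k] of the tensor, grouped by edges: a product over an edge
    occurs once for each of its [k] vertices. *)
Definition hform (H : hypergraph) (x : H -> R) : R :=
  \sum_(e in edges H) (alpha * (\sum_(v in e) x v ^+ k) +
                       (1 - alpha) * k%:R * \prod_(v in e) x v).

Lemma hformZ (H : hypergraph) (c : R) (x : H -> R) : uniform k H ->
  hform (fun v => c * x v) = c ^+ k * hform x.
Proof.
move=> uH; rewrite /hform mulr_sumr; apply: eq_bigr => e eH.
rewrite big_split/= prodr_const (uH e eH).
under eq_bigr do rewrite exprMn.
by rewrite -mulr_sumr; ring.
Qed.

(** The nonnegative vectors with [sum x_v^k = 1] form a compact set, so the form attains its maximum
    there; homogeneity of degree [k] extends the bound to every nonnegative vector. *)
Lemma hform_max (H : hypergraph) : uniform k H -> (0 < k)%N ->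
  exists r, exists x : H -> R,
    [/\ forall v, 0 <= x v, \sum_v x v ^+ k = 1, hform x = r &
        forall y : H -> R, (forall v, 0 <= y v) ->
          hform y <= r * \sum_v y v ^+ k].
Proof.
move=> uH k_gt0.
pose g (v : 'rV[R]_#|H|) : H -> R := fun i => v ord0 (enum_rank i).
have gc i : continuous (fun v => g v i) by exact: coord_continuous.
have gpc i : continuous (fun v => g v i ^+ k) by exact: exprX_continuous.
have fc : continuous (fun v => hform (g v)).
  have cst_c (a : R) : continuous (fun v : 'rV[R]_#|H| => a) by exact: cst_continuous.
  apply: sumr_continuous => e x.
  apply: (@continuousD _ _ _ (fun v => alpha * \sum_(i in e) g v i ^+ k)
    (fun v => (1 - alpha) * k%:R * \prod_(i in e) g v i));
    apply: continuousM; try exact: cst_c.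
    exact: (@sumr_continuous _ _ _ _ _ (fun i v => g v i ^+ k)).
  exact: (@prodr_continuous _ _ _ _ _ (fun i v => g v i)).
pose N v : R := \sum_i g v i ^+ k.
have Nc : continuous N by exact: (@sumr_continuous _ _ _ _ _ (fun i v => g v i ^+ k)).
pose B : set 'rV[R]_#|H| :=
  [set v : 'rV[R]_#|H| | forall i, v ord0 i \in `[0, 1]%R]%classic.
pose K := (B `&` N @^-1` [set 1])%classic.
have Bcpt : compact B.
  by apply: (@rV_compact R _ (fun=> `[0, 1]%classic)) => i; exact: segment_compact.
have Kcpt : compact K.
  apply: compact_closedI => //; apply: preimage_closed.
    by move=> ? _; exact: Nc.
  exact: closed_eq.
have H0 := vertex_gt0 H.
have K0 : (K !=set0)%classic.
  pose v0 : 'rV[R]_#|H| := \row_i (i == Ordinal H0)%:R.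
  exists v0; split.
    by move=> i /=; rewrite mxE in_itv/=; case: eqP => _; rewrite ?lexx ?ler01.
  rewrite /= /N (bigD1 (enum_val (Ordinal H0)))//= big1 ?addr0.
    by rewrite /g mxE enum_valK eqxx expr1n.
  move=> i; rewrite -(inj_eq enum_rank_inj) enum_valK => /negPf ni.
  by rewrite /g mxE ni expr0n gtn_eqF.
have [|v] := compact_EVT_max (f := fun v => hform (g v)) K0 Kcpt.
  exact: continuous_subspaceT.
rewrite inE => -[Bv Nv] maxv.
exists (hform (g v)), (g v); split => //.
  by move=> i; have /= := Bv (enum_rank i); rewrite in_itv/= => /andP[].
move=> y y_ge0; set s := \sum_v _.
have yk_ge0 i : 0 <= y i ^+ k by exact: exprn_ge0.
have s_ge0 : 0 <= s by apply: sumr_ge0.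
have [t t_ge0 tk] := nonneg_root k_gt0 s_ge0.
(* A vector of norm zero cannot be normalised, but it equals [0 * y], so homogeneity settles this
   case. *)
have [t0|t_neq0] := eqVneq t 0.
  have s0 : s = 0 by rewrite -tk t0 expr0n gtn_eqF.
  rewrite s0 mulr0 (_ : y = fun v => 0 * y v); last first.
    apply/funext => i; rewrite mul0r; apply/eqP.
    have /eqP := s0; rewrite psumr_eq0// => /allP/(_ i).
    by rewrite mem_index_enum expf_eq0 k_gt0/= => /(_ isT).
  by rewrite hformZ// expr0n gtn_eqF// mul0r.
pose z i := t^-1 * y i.
have -> : y = fun v => t * z v.
  by apply/funext => i; rewrite /z mulrA divff// mul1r.
have z_ge0 i : 0 <= z i by rewrite mulr_ge0// invr_ge0.
have zk : \sum_i z i ^+ k = 1.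
  under eq_bigr do rewrite exprMn.
  by rewrite -mulr_sumr exprVn tk mulVf// -tk expf_neq0.
rewrite hformZ// tk mulrC; apply: ler_wpM2r => //.
pose w : 'rV[R]_#|H| := \row_i z (enum_val i).
have gw : g w = z by apply/funext => i; rewrite /g mxE enum_rankK.
rewrite -gw; apply: maxv; rewrite inE; split; last by rewrite /= /N gw.
move=> i /=; rewrite mxE in_itv/= z_ge0/=.
rewrite -(@ler_pXn2r _ k)// ?nnegrE// expr1n -zk (bigD1 (enum_val i))//= lerDl.
by apply: sumr_ge0 => j _; exact: exprn_ge0.
Qed.

End Form.

(** * Variational characterisation of the spectral radius *)

Section SpectralRadius.
Variables (R : realType) (k : nat) (alpha : R).

Definition link (A : comPzSemiRingType) (H : hypergraph) (x : H -> A) (i : H) : A :=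
  \sum_(e in edges H | i \in e) \prod_(j in e :\ i) x j.

Lemma sum_incidence (A : nmodType) (H : hypergraph)
    (f : H -> {set H} -> A) :
  \sum_i \sum_(e in edges H | i \in e) f i e =
  \sum_(e in edges H) \sum_(i in e) f i e.
Proof.
rewrite (exchange_big_dep (mem (edges H)))/=; last by move=> i e _ /andP[].
by apply: eq_bigr => e eH; apply: eq_bigl => i; rewrite eH.
Qed.

Lemma hform_ge0 (H : hypergraph) (x : H -> R) :
  0 <= alpha <= 1 -> (forall v, 0 <= x v) -> 0 <= hform k alpha x.
Proof.
move=> /andP[a_ge0 a_le1] x_ge0.
apply: sumr_ge0 => e _; apply: addr_ge0; apply: mulr_ge0 => //.
- by apply: sumr_ge0 => v _; exact: exprn_ge0.
- by rewrite mulr_ge0 ?subr_ge0.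
- exact: prodr_ge0.
Qed.

(** Double counting of incidences between vertices and edges; this links the form to the eigenvalue
    equations. *)
Lemma hform_linkE (H : hypergraph) (x : H -> R) :
  uniform k H -> (0 < k)%N ->
  hform k alpha x =
  \sum_i x i * (alpha * (degree i)%:R * x i ^+ k.-1 + (1 - alpha) * link x i).
Proof.
move=> uH k_gt0.
transitivity (\sum_i \sum_(e in edges H | i \in e)
    (alpha * x i ^+ k + (1 - alpha) * \prod_(j in e) x j)).
  rewrite sum_incidence; apply: eq_bigr => e eH.
  rewrite big_split/= -mulr_sumr sumr_const (uH e eH).
  by congr (_ + _); rewrite mulrAC mulr_natr.
apply: eq_bigr => i _; rewrite big_split/= sumr_const mulrDr; congr (_ + _).
  rewrite -[in LHS](prednK k_gt0) exprS /degree cardsE -mulr_natr; ring.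
rewrite -mulr_sumr [RHS]mulrCA; congr (_ * _); rewrite /link mulr_sumr.
by apply: eq_bigr => e /andP[_ ie]; rewrite (big_setD1 i).
Qed.

(** An edge contains [i] at most once, so as a function of the single coordinate [s] at [i] the form
    has only an [s^k] term, an [s] term and a constant. *)
Lemma hform_update (H : hypergraph) (x : H -> R) (i : H) : exists a, forall s,
  hform k alpha (fun v => if v == i then s else x v) =
  alpha * (degree i)%:R * s ^+ k + k%:R * ((1 - alpha) * link x i) * s + a.
Proof.
exists (\sum_(e in edges H | i \in e) alpha * \sum_(v in e :\ i) x v ^+ k +
  \sum_(e in edges H | i \notin e)
    (alpha * \sum_(v in e) x v ^+ k + (1 - alpha) * k%:R * \prod_(v in e) x v)).
move=> s; rewrite /hform (bigID (fun e : {set H} => i \in e))/= [RHS]addrA.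
congr (_ + _); last first.
  apply: eq_bigr => e /andP[_ ie].
  have xE v : v \in e -> (if v == i then s else x v) = x v.
    by case: eqP => // ->; rewrite (negPf ie).
  congr (_ * _ + _ * _); first by apply: eq_bigr => v /xE ->.
  exact: eq_bigr.
have xE (e : {set H}) v : v \in e :\ i -> (if v == i then s else x v) = x v.
  by rewrite !inE => /andP[/negPf ->].
rewrite (eq_bigr (fun e : {set H} => alpha * s ^+ k +
    k%:R * (1 - alpha) * s * (\prod_(v in e :\ i) x v) +
    alpha * \sum_(v in e :\ i) x v ^+ k)).
  rewrite !big_split/= sumr_const /degree cardsE -mulr_sumr -/(link x i).
  by rewrite -[in LHS]mulr_natr; ring.
move=> e /andP[_ ie]; rewrite (big_setD1 i ie)/=.
rewrite [\prod_(v in e) _](big_setD1 i ie)/= eqxx.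
rewrite (eq_bigr (fun v => x v ^+ k)); last by move=> v /xE ->.
rewrite (eq_bigr x); last by move=> v /xE ->.
by ring.
Qed.

(** Varying only [x i], the nonnegative difference [r * sum x_v^k - F(x)] is zero at the maximiser,
    hence minimal there. Its stationarity in that coordinate is the [i]-th eigenvalue equation, also
    when [x i = 0]. *)
Lemma maximizer_eigen (H : hypergraph) (x : H -> R) (r : R) :
    (1 < k)%N -> alpha <= 1 -> (forall v, 0 <= x v) ->
    hform k alpha x = r * \sum_v x v ^+ k ->
    (forall y : H -> R, (forall v, 0 <= y v) ->
       hform k alpha y <= r * \sum_v y v ^+ k) ->
  forall i, alpha * (degree i)%:R * x i ^+ k.-1 + (1 - alpha) * link x i =
            r * x i ^+ k.-1.
Proof.
move=> k_gt1 a_le1 x_ge0 fx fmax i.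
have [a fE] := hform_update x i.
have xi : x = fun v => if v == i then x i else x v.
  by apply/funext => v; case: eqP => [->|].
have sE s : \sum_v (if v == i then s else x v) ^+ k =
            s ^+ k + \sum_(v | v != i) x v ^+ k.
  by rewrite (bigD1 i)//= eqxx; congr (_ + _); apply: eq_bigr => v /negPf ->.
have link_ge0 : 0 <= (1 - alpha) * link x i.
  by rewrite mulr_ge0 ?subr_ge0// sumr_ge0// => e _; rewrite prodr_ge0.
rewrite -(@stationary_at_min R k (r - alpha * (degree i)%:R) _ (x i)
  k_gt1 link_ge0 (x_ge0 i)); first by rewrite mulrBl addrC subrK.
move=> s s_ge0.
have /fmax : forall v, 0 <= (if v == i then s else x v) by move=> v; case: eqP.
rewrite fE /= sE => le_s.
have := sE (x i); move: fx; rewrite [in LHS]xi fE => fx sx.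
move: fx; rewrite (_ : \sum_v x v ^+ k =
    \sum_v (if v == i then x i else x v) ^+ k); last first.
  by apply: eq_bigr => v _; rewrite {1}xi.
rewrite sx => fx.
by lra.
Qed.

(** Take the moduli of the coordinates of an eigenvector: the triangle inequality in each equation,
    multiplied by the modulus at [i] and summed, gives the bound. *)
Lemma hform_le_max_of_eigen (H : hypergraph) (lambda : R[i]) :
    uniform k H -> (0 < k)%N -> 0 <= alpha <= 1 ->
    alpha_eigenvalue k alpha H lambda ->
  exists x : H -> R, [/\ forall v, 0 <= x v, 0 < \sum_v x v ^+ k &
    Normc.normc lambda * \sum_v x v ^+ k <= hform k alpha x].
Proof.
move=> uH k_gt0 /andP[a_ge0 a_le1] [y y_neq0 yE].
pose z v := Normc.normc (y v).
have zE v : `|y v| = (z v)%:C%C by [].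
have z_ge0 v : 0 <= z v by rewrite -lecR -zE normr_ge0.
exists z; split => //.
  rewrite lt0r sumr_ge0 ?andbT; last by move=> v _; exact: exprn_ge0.
  rewrite psumr_eq0; last by move=> v _; exact: exprn_ge0.
  apply: contra y_neq0 => /allP z0; apply/eqP/ffunP => v; rewrite ffunE.
  have := z0 v; rewrite mem_index_enum expf_eq0 k_gt0/= => /(_ isT)/eqP.
  by move/Normc.eq0_normc.
rewrite hform_linkE// mulr_sumr; apply: ler_sum => i _.
rewrite -[in leLHS](prednK k_gt0) exprS mulrCA ler_wpM2l//.
rewrite -lecR rmorphM rmorphXn/= -!zE -[(Normc.normc lambda)%:C%C]/(`|lambda|).
rewrite -normrX -normrM -yE (le_trans (ler_normD _ _))//.
rewrite [leRHS]rmorphD !rmorphM/= rmorph_nat rmorphXn/= -!zE lerD//.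
  by rewrite !normrM normrX normr_nat ger0_norm// lecR.
have a1_ge0 : 0 <= (1 - alpha)%:C%C by rewrite lecR subr_ge0.
rewrite normrM ger0_norm// ler_wpM2l//.
rewrite /link rmorph_sum/= (le_trans (ler_norm_sum _ _ _))// ler_sum// => e _.
by rewrite rmorph_prod/= normr_prod.
Qed.

(** The maximum of the form is itself an eigenvalue, with the maximiser as eigenvector, and it
    dominates the modulus of every other eigenvalue. *)
Lemma spectral_radius_exists (H : hypergraph) :
    uniform k H -> (1 < k)%N -> 0 <= alpha <= 1 ->
  exists r, exists x : H -> R,
    [/\ is_alpha_spectral_radius k alpha H r,
        forall v, 0 <= x v, \sum_v x v ^+ k = 1, hform k alpha x = r &
        forall y : H -> R, (forall v, 0 <= y v) ->
          hform k alpha y <= r * \sum_v y v ^+ k].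
Proof.
move=> uH k_gt1 /andP[a_ge0 a_le1]; have k_gt0 := ltnW k_gt1.
have [r [x [x_ge0 x1 xr xmax]]] := hform_max alpha uH k_gt0.
exists r, x; split => //.
have r_ge0 : 0 <= r by rewrite -xr hform_ge0// a_ge0.
split; last first.
  move=> l /(hform_le_max_of_eigen uH k_gt0)[|z [z_ge0 z_gt0 zl]].
    by rewrite a_ge0.
  rewrite -[`|l|]/((Normc.normc l)%:C%C) lecR.
  by rewrite -(ler_pM2r z_gt0) (le_trans zl)// xmax.
exists (r%:C)%C; last by rewrite ger0_norm// lecR.
exists [ffun v => (x v)%:C%C].
  apply/eqP => /ffunP x0; have := oner_eq0 R; rewrite -x1 big1 ?eqxx// => v _.
  by have := x0 v; rewrite !ffunE => -[->]; rewrite expr0n gtn_eqF.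
move=> i; rewrite !ffunE.
have xr' : hform k alpha x = r * \sum_v x v ^+ k by rewrite x1 mulr1.
have := maximizer_eigen k_gt1 a_le1 x_ge0 xr' xmax i.
move=> /(congr1 (real_complex R)).
rewrite rmorphD !rmorphM/= rmorph_nat rmorphXn/= => <-.
congr (_ + _ * _); rewrite /link rmorph_sum/=; apply: eq_bigr => e _.
by rewrite rmorph_prod; apply: eq_bigr => v _; rewrite ffunE.
Qed.

Lemma spectral_radius_unique (H : hypergraph) (r s : R) :
  is_alpha_spectral_radius k alpha H r ->
  is_alpha_spectral_radius k alpha H s -> r = s.
Proof.
move=> [[l Hl rl] maxr] [[l' Hl' sl'] maxs]; apply/le_anti.
by rewrite -!lecR -{1}rl -{2}sl' maxs// maxr.
Qed.

Lemma radius_ge0 (H : hypergraph) (r : R) :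
  is_alpha_spectral_radius k alpha H r -> 0 <= r.
Proof. by move=> [[l _ lr] _]; rewrite -lecR -lr normr_ge0. Qed.

Lemma hform_le_radius (H : hypergraph) (r : R) (y : H -> R) :
    uniform k H -> (1 < k)%N -> 0 <= alpha <= 1 ->
    is_alpha_spectral_radius k alpha H r -> (forall v, 0 <= y v) ->
  hform k alpha y <= r * \sum_v y v ^+ k.
Proof.
move=> uH k_gt1 a01 Hr; have [s [x [Hs _ _ _]]] := spectral_radius_exists uH k_gt1 a01.
by rewrite (spectral_radius_unique Hr Hs); apply.
Qed.

End SpectralRadius.

(** * The number [h], weighted AM-GM and the test-vector bound *)

Lemma card_bigcup_leq (I T : finType) (F : {set I}) (f : I -> {set T}) :
  (#|\bigcup_(i in F) f i| <= \sum_(i in F) #|f i|)%N.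
Proof.
elim/big_ind2: _ => [|A m B n Am Bn|//]; first by rewrite cards0.
by rewrite (leq_trans (leq_card_setU _ _))// leq_add.
Qed.

(** Putting [x = 2h + 2 alpha] turns this into the defining equation of [lambda_k(alpha)]. The
    intermediate value theorem applies on [[0,1]]: at [1] the left side is at least 1, at [0] it
    vanishes. *)
Lemma exists_half_gap (R : realType) (k : nat) (alpha : R) :
  0 <= alpha < 1 ->
  exists2 h, 0 < h & h ^+ 2 * (2 * h + alpha) ^+ (k - 2) = (1 - alpha) ^+ k.
Proof.
move=> /andP[a_ge0 a_lt1].
pose p : {poly R} :=
  'X^2 * (2 *: 'X + alpha%:P) ^+ (k - 2) - ((1 - alpha) ^+ k)%:P.
have pE x : p.[x] = x ^+ 2 * (2 * x + alpha) ^+ (k - 2) - (1 - alpha) ^+ k.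
  by rewrite /p !hornerE.
have a1_gt0 : 0 < 1 - alpha by rewrite subr_gt0.
have [|h] := @poly_ivt R p 0 1 ler01.
  rewrite !pE expr0n mul0r sub0r oppr_le0 exprn_ge0 ?(ltW a1_gt0)//=.
  rewrite expr1n mul1r subr_ge0 (@le_trans _ _ 1)//.
    by rewrite exprn_ile1 ?(ltW a1_gt0)// lerBlDr lerDl.
  by rewrite exprn_ege1// mulr1 ler_wpDr// ler1n.
move=> /andP[h_ge0 _] /rootP; rewrite pE => /eqP; rewrite subr_eq0.
move=> /eqP hE; exists h => //; rewrite lt0r h_ge0 andbT; apply/eqP => h0.
by move: hE; rewrite h0 expr0n mul0r => /esym/eqP; rewrite expf_eq0 gt_eqF// andbF.
Qed.

(** AM-GM for the [k] numbers [B v * x v ^+ k], whose product is the [k]-th power of [c] times the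
    edge product. *)
Lemma prod_le_weighted_sum (R : realFieldType) (T : finType) (k : nat) (c : R)
    (e : {set T}) (B x : T -> R) :
    #|e| = k -> (0 < k)%N -> 0 <= c ->
    (forall v, 0 <= B v) -> (forall v, 0 <= x v) ->
    \prod_(v in e) B v = c ^+ k ->
  c * k%:R * \prod_(v in e) x v <= \sum_(v in e) B v * x v ^+ k.
Proof.
move=> ek k_gt0 c_ge0 B_ge0 x_ge0 prodB.
have E_ge0 v : 0 <= B v * x v ^+ k by rewrite mulr_ge0// exprn_ge0.
have k_pos : 0 < k%:R :> R by rewrite ltr0n.
rewrite mulrAC -ler_pdivlMr// -(@ler_pXn2r _ k)// ?nnegrE.
- have := (@leif_AGM _ _ (mem e) (fun v => B v * x v ^+ k) (fun v _ => E_ge0 v)).1.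
  by rewrite -[#|_|]/#|e| ek big_split/= prodB prodrXl -exprMn.
- by rewrite mulr_ge0// prodr_ge0.
- by rewrite divr_ge0// ?sumr_ge0// ltW.
Qed.

Section Bounds.
Variables (R : realType) (k : nat) (alpha h : R).
Hypothesis k_ge3 : (3 <= k)%N.
Hypothesis alpha_ge0 : 0 <= alpha.
Hypothesis alpha_lt1 : alpha < 1.
Hypothesis h_gt0 : 0 < h.
Hypothesis hE : h ^+ 2 * (2 * h + alpha) ^+ (k - 2) = (1 - alpha) ^+ k.

Let b := 2 * h + alpha.
Let b_gt0 : 0 < b.
Proof. by rewrite /b ltr_wpDr// mulr_gt0. Qed.
Let k_gt0 : (0 < k)%N. Proof. exact: leq_trans k_ge3. Qed.
Let k_gt1 : (1 < k)%N. Proof. exact: leq_trans k_ge3. Qed.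
Let alpha01 : 0 <= alpha <= 1. Proof. by rewrite alpha_ge0 ltW. Qed.

(* Test vector: [h^(-1/k)] on Z, [(2h + alpha)^(-1/k)] on the other vertices of
   the edges of F. *)
Lemma radius_lower_bound (H : hypergraph) (r : R) (Z : {set H})
    (F : {set {set H}}) :
    uniform k H -> is_alpha_spectral_radius k alpha H r ->
    F \subset edges H -> (forall e, e \in F -> #|e :&: Z| = 2%N) ->
  #|F|%:R * ((2 * h + 2 * alpha) * (h^-1 + (k - 2)%:R / b)) <=
  r * (#|Z|%:R / h + #|F|%:R * ((k - 2)%:R / b)).
Proof.
move=> uH Hr FE FZ.
have [|s s_ge0 sk] := @nonneg_root R k h^-1 k_gt0.
  by rewrite invr_ge0 ltW.
have [|t t_ge0 tk] := @nonneg_root R k b^-1 k_gt0.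
  by rewrite invr_ge0 ltW.
(* The defining equation of [h] normalises the test vector: the product over an edge of [F], times
   [1 - alpha], is 1. *)
have prod1 : (1 - alpha) * (s ^+ 2 * t ^+ (k - 2)) = 1.
  apply/eqP; rewrite -(@eqrXn2 _ k)//; last first.
    by rewrite !mulr_ge0 ?exprn_ge0// subr_ge0 ltW.
  rewrite expr1n !exprMn -!exprM ![(_ * k)%N]mulnC !exprM sk tk -hE -/b.
  have hh : h * h^-1 = 1 by rewrite divff ?gt_eqF.
  have bb : b * b^-1 = 1 by rewrite divff ?gt_eqF.
  by rewrite mulrACA -[b ^+ _ * _]exprMn bb expr1n mulr1 expr2 mulrACA hh mulr1.
pose x v := if v \in Z then s else if v \in finset.cover F then t else 0.
have x_ge0 v : 0 <= x v by rewrite /x; case: ifP => // _; case: ifP.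
have xk_ge0 v : 0 <= x v ^+ k by exact: exprn_ge0.
have xZ v : v \in Z -> x v = s by rewrite /x => ->.
have xF e v : e \in F -> v \in e :\: Z -> x v = t.
  move=> eF; rewrite inE /x => /andP[/negPf -> ve].
  by rewrite (_ : v \in finset.cover F)//; apply/finset.bigcupP; exists e.
have cardF e : e \in F -> #|e :\: Z| = (k - 2)%N.
  move=> eF; rewrite -(FZ e eF) -(uH e (fintype.subsetP FE _ eF)).
  by rewrite -(cardsID Z e) addnC addnK.
apply: le_trans (le_trans (hform_le_radius uH k_gt1 alpha01 Hr x_ge0) _).
  have term_ge0 (e : {set H}) : 0 <= alpha * (\sum_(v in e) x v ^+ k) +
                         (1 - alpha) * k%:R * \prod_(v in e) x v.
    apply: addr_ge0; apply: mulr_ge0 => //; first exact: sumr_ge0.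
      by rewrite mulr_ge0// subr_ge0 ltW.
    exact: prodr_ge0.
  rewrite /hform (big_setID F)/= (finset.setIidPr FE) ler_wpDr//; first exact: sumr_ge0.
  rewrite mulr_natl -sumr_const; apply: ler_sum => e eF.
  rewrite (big_setID Z)/= [\prod_(v in e) x v](big_setID Z)/=.
  rewrite (eq_bigr (fun=> h^-1)); last first.
    by move=> v; rewrite inE => /andP[_ /xZ ->].
  rewrite [\prod_(i in e :&: Z) x i](eq_bigr (fun=> s)); last first.
    by move=> v; rewrite inE => /andP[_ /xZ ->].
  rewrite [\sum_(i in e :\: Z) _](eq_bigr (fun=> b^-1)); last first.
    by move=> v /(xF e v eF) ->.
  rewrite [\prod_(i in e :\: Z) x i](eq_bigr (fun=> t)); last first.
    by move=> v /(xF e v eF) ->.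
  rewrite !sumr_const !prodr_const FZ// cardF//.
  rewrite mulrAC prod1 mul1r -[b^-1 *+ _]mulr_natl.
  (* Each edge of [F] contributes [alpha (2/h + (k-2)/b) + k]; since [2h + 2 alpha = b + alpha],
     this is [(2h + 2 alpha)(1/h + (k-2)/b)]. *)
  have -> : k%:R = 2 + (k - 2)%:R :> R by rewrite -natrD subnKC// ltnW.
  have b_neq0 : b != 0 by rewrite gt_eqF.
  have h_neq0 : h != 0 by rewrite gt_eqF.
  rewrite le_eqVlt; apply/orP; left; apply/eqP.
  by move: b_neq0; rewrite /b => b_neq0; field; rewrite h_neq0 b_neq0.
apply: ler_wpM2l.
  exact: radius_ge0 Hr.
rewrite (bigID (mem Z))/= (eq_bigr (fun=> h^-1)); last by move=> v /xZ ->.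
rewrite sumr_const -[_ *+ _]mulr_natl lerD2l.
rewrite (bigID (mem (finset.cover F)))/= [X in _ + X]big1 ?addr0; last first.
  move=> v /andP[/negPf vZ /negPf vF].
  by rewrite /x vZ vF expr0n gtn_eqF.
rewrite (eq_bigr (fun=> b^-1)); last first.
  by move=> v /andP[/negPf vZ vF]; rewrite /x vZ vF.
rewrite sumr_const -[_ *+ _]mulr_natl mulrA ler_wpM2r ?invr_ge0 ?(ltW b_gt0)//.
rewrite -natrM ler_nat.
(* Edges of [F] may overlap outside [Z], so the vertices there are only bounded by their count with
   multiplicity. *)
have -> : (#|F| * (k - 2) = \sum_(e in F) #|e :\: Z|)%N.
  by rewrite -sum_nat_const; apply: eq_bigr => e /cardF.
rewrite (leq_trans _ (card_bigcup_leq _ _))//; apply/subset_leq_card.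
apply/fintype.subsetP => v /andP[vZ /finset.bigcupP[e eF ve]].
by apply/finset.bigcupP; exists e => //; rewrite inE vZ.
Qed.

End Bounds.

(** * Power hypergraphs of multigraphs *)

Section PowerHypergraph.
Variables (k n m : nat) (src tgt : 'I_m -> 'I_n).
Hypothesis k_ge3 : (3 <= k)%N.
Hypothesis src_tgt : forall i, src i != tgt i.

(** Edge [i] of a loopless multigraph on ['I_n] receives [k - 2] private vertices. Parallel edges
    are allowed, as the loose cycle with two edges requires. The encoding is convertible with that
    of [loose_cycle]. *)
Definition power_vertex : finType := ('I_n + 'I_m * 'I_(k - 2))%type.

Definition power_edge (i : 'I_m) : {set power_vertex} :=
  inl (src i) |: (inl (tgt i) |: [set inr (i, j) | j : 'I_(k - 2)]).

Definition power_edges : {set {set power_vertex}} :=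
  [set power_edge i | i : 'I_m].

Definition power_core : {set power_vertex} := [set inl c | c : 'I_n].

Lemma card_power_core : #|power_core| = n.
Proof. by rewrite card_imset ?card_ord// => i j []. Qed.

Lemma big_power_edge (A : Type) (idx : A) (op : Monoid.com_law idx)
    (f : power_vertex -> A) (i : 'I_m) :
  \big[op/idx]_(v in power_edge i) f v =
  op (f (inl (src i))) (op (f (inl (tgt i)))
    (\big[op/idx]_(j < k - 2) f (inr (i, j)))).
Proof.
rewrite big_setU1/=; last first.
  rewrite !inE negb_or; apply/andP; split.
    by apply: contra (src_tgt i) => /eqP[->].
  by apply/imsetP => -[].
rewrite big_setU1/=; last by apply/imsetP => -[].
by rewrite big_imset//= => j j' _ _ [].
Qed.

Lemma mem_power_edge_inl (i : 'I_m) (c : 'I_n) :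
  (inl c \in power_edge i) = (c == src i) || (c == tgt i).
Proof.
rewrite !inE; congr (_ || _).
by rewrite orbC; case: imsetP => [[]|].
Qed.

Lemma mem_power_edge_inr (i i' : 'I_m) (j : 'I_(k - 2)) :
  (inr (i', j) \in power_edge i) = (i' == i).
Proof.
rewrite !inE /=; apply/imsetP/eqP => [[j' _ []]//|->].
by exists j.
Qed.

Lemma power_edge_inj : injective power_edge.
Proof.
have k2 : (0 < k - 2)%N by rewrite subn_gt0.
move=> i i' ii'; apply/eqP.
by rewrite -(mem_power_edge_inr i' i (Ordinal k2)) -ii' mem_power_edge_inr.
Qed.

Lemma card_power_edge i : #|power_edge i| = k.
Proof.
rewrite -sum1_card big_power_edge sum1_card card_ord/= addnA.
by rewrite addn1 add2n; lia.
Qed.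

Lemma card_power_edgeI i : #|power_edge i :&: power_core| = 2%N.
Proof.
rewrite (_ : _ :&: _ = [set inl (src i); inl (tgt i)]).
  by rewrite cards2 (_ : inl _ != inl _)//; apply: contra (src_tgt i) => /eqP[->].
apply/setP => -[c|[i' j]]; rewrite inE ?mem_power_edge_inl ?mem_power_edge_inr !inE.
  rewrite (_ : inl c \in power_core) ?andbT//; first exact: imset_f.
by rewrite (_ : inr _ \in power_core = false) ?andbF//; apply/imsetP => -[].
Qed.

Lemma card_power_edges : #|power_edges| = m.
Proof. by rewrite card_imset ?card_ord//; exact: power_edge_inj. Qed.

Lemma sum_power_vertex (A : nmodType) (f : power_vertex -> A) :
  \sum_v f v = \sum_c f (inl c) + \sum_i \sum_j f (inr (i, j)).
Proof. by rewrite big_sumType/= pair_bigA/=; congr (_ + _); apply: eq_bigr => -[]. Qed.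

Section Form.
Variables (R : realType) (alpha : R).
Variables (V0 : (0 < #|power_vertex|)%N) (E0 : finset.set0 \notin power_edges).
Let H := @Hypergraph power_vertex power_edges V0 E0.

Lemma uniform_power : uniform k H.
Proof. by move=> e /imsetP[i _ ->]; exact: card_power_edge. Qed.

Lemma hform_power (x : H -> R) : hform k alpha x =
  \sum_i (alpha * (x (inl (src i)) ^+ k + (x (inl (tgt i)) ^+ k +
                   \sum_j x (inr (i, j)) ^+ k)) +
          (1 - alpha) * k%:R * (x (inl (src i)) * (x (inl (tgt i)) *
                   \prod_j x (inr (i, j))))).
Proof.
rewrite /hform big_imset/=; last by move=> i j _ _; exact: power_edge_inj.
by apply: eq_bigr => i _; rewrite !big_power_edge.
Qed.

Variable h : R.
Hypothesis alpha_ge0 : 0 <= alpha.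
Hypothesis alpha_lt1 : alpha < 1.
Hypothesis h_gt0 : 0 < h.
Hypothesis hE : h ^+ 2 * (2 * h + alpha) ^+ (k - 2) = (1 - alpha) ^+ k.

(** AM-GM on each edge with weights [h p], [h / p] at the two core vertices and [2h + alpha] at the
    private ones: [p] cancels in the product, which is [(1 - alpha)^k]. The free [p i] distributes
    the weight between the two ends. *)
Lemma hform_power_le (p : 'I_m -> R) (x : H -> R) :
    (forall i, 0 < p i) -> (forall v, 0 <= x v) ->
  hform k alpha x <=
  \sum_i ((alpha + h * p i) * x (inl (src i)) ^+ k +
          (alpha + h / p i) * x (inl (tgt i)) ^+ k) +
  (2 * h + 2 * alpha) * \sum_i \sum_j x (inr (i, j)) ^+ k.
Proof.
move=> p_gt0 x_ge0; rewrite hform_power mulr_sumr -big_split/=.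
apply: ler_sum => i _.
pose B (v : power_vertex) : R := match v with
  | inl c => if c == src i then h * p i else h / p i
  | inr _ => 2 * h + alpha end.
have B_ge0 v : 0 <= B v.
  case: v => [c|_] /=; last by rewrite addr_ge0// mulr_ge0// ltW.
  by case: ifP => _; apply: ltW; [exact: mulr_gt0|exact: divr_gt0].
have := @prod_le_weighted_sum R power_vertex k (1 - alpha) (power_edge i) B x
  (card_power_edge i) (ltnW (ltnW k_ge3)) _ B_ge0 x_ge0.
rewrite !big_power_edge/= eqxx eq_sym (negPf (src_tgt i)) prodr_const card_ord.
rewrite subr_ge0 (ltW alpha_lt1) -mulr_sumr => /(_ isT) le_prod.
have p_neq0 : p i != 0 by rewrite gt_eqF.
have prodB : h * p i * (h / p i * (2 * h + alpha) ^+ (k - 2)) =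
    (1 - alpha) ^+ k.
  by rewrite -hE; field.
have {}le_prod := le_prod prodB.
move: le_prod; set P := _ * (x _ * _); set S := \sum_(j < _) _.
set X := x _ ^+ k; set Y := x _ ^+ k => le_prod.
by lra.
Qed.

Lemma power_radius_lower (r : R) :
  is_alpha_spectral_radius k alpha H r ->
  m%:R * ((2 * h + 2 * alpha) * (h^-1 + (k - 2)%:R / (2 * h + alpha))) <=
  r * (n%:R / h + m%:R * ((k - 2)%:R / (2 * h + alpha))).
Proof.
move=> Hr; have := radius_lower_bound k_ge3 alpha_ge0 alpha_lt1 h_gt0 hE
  (H := H) (Z := power_core) (F := power_edges) uniform_power Hr (subxx _).
rewrite card_power_core card_power_edges; apply.
move=> e /imsetP[i _ ->]; exact: card_power_edgeI.
Qed.

End Form.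
End PowerHypergraph.

(** * The spectral radius of loose cycles *)

Lemma ordS_neq (m : nat) (i : 'I_m) : (1 < m)%N -> i != ordS i.
Proof.
move=> m_gt1; rewrite -val_eqE /=; have := ltn_ord i.
rewrite leq_eqVlt => /predU1P[im|im]; last by rewrite modn_small// neq_ltn leqnn.
by rewrite im modnn; lia.
Qed.

(** On a cycle every core vertex is once a source and once a target, so [p = 1] gives the
    coefficient [2h + 2 alpha] everywhere; the lower bound matches because there are as many core
    vertices as edges. *)
Lemma loose_cycle_radius (R : realType) (k : nat) (alpha h : R) :
    (3 <= k)%N -> 0 <= alpha -> alpha < 1 -> 0 < h ->
    h ^+ 2 * (2 * h + alpha) ^+ (k - 2) = (1 - alpha) ^+ k ->
  is_lambda k alpha (2 * h + 2 * alpha).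
Proof.
move=> k_ge3 a_ge0 a_lt1 h_gt0 hE m m_gt1.
have k_gt1 := ltnW k_ge3.
have a01 : 0 <= alpha <= 1 by rewrite a_ge0 ltW.
have st (i : 'I_m) : id i != ordS i by exact: ordS_neq.
have uH : uniform k (loose_cycle k m_gt1) := 
  @uniform_power k m m id (@ordS m) k_ge3 st (loose_cycle_vertex_gt0 k m_gt1)
    (loose_cycle_edges_neq0 k m).
have [r [x [Hr x_ge0 x1 xr _]]] := spectral_radius_exists uH k_gt1 a01.
suff <- : r = 2 * h + 2 * alpha by [].
apply/le_anti/andP; split.
  have := @hform_power_le k m m id (@ordS m) k_ge3 st R alpha
    (loose_cycle_vertex_gt0 k m_gt1) (loose_cycle_edges_neq0 k m)
    h a_ge0 a_lt1 h_gt0 hE (fun=> 1) x (fun=> ltr01) x_ge0.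
  rewrite -[X in X <= _]/(hform k alpha x) xr => /le_trans; apply.
  rewrite big_split/= mulr1 divr1 -!mulr_sumr.
  (* The sum over targets is a cyclic shift of the sum over sources. *)
  rewrite -(reindex_inj (h := @ordS m) (P := xpredT)
    (F := fun i => x (inl i) ^+ k))/=; last first.
    exact: can_inj (@ordSK m).
  move: x1; rewrite (@sum_power_vertex k m m R (fun v => x v ^+ k)) => x1.
  rewrite -mulrDl -[leRHS]mulr1 -[X in _ <= _ * X]x1.
  by rewrite le_eqVlt; apply/orP; left; apply/eqP; ring.
have := @power_radius_lower k m m id (@ordS m) k_ge3 st R alpha
    (loose_cycle_vertex_gt0 k m_gt1) (loose_cycle_edges_neq0 k m)
    h a_ge0 a_lt1 h_gt0 hE r Hr.
have b_gt0 : 0 < 2 * h + alpha by rewrite ltr_wpDr// mulr_gt0.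
set c := h^-1 + _; rewrite -[X in r * X]mulrDr -/c mulrCA ler_pM2r//.
by rewrite mulr_gt0 ?ltr0n ?(ltnW m_gt1)// ltr_wpDr ?invr_gt0// divr_ge0// ltW.
Qed.

(** * Loose paths and their radii *)

Definition path_src (m : nat) : 'I_m -> 'I_m.+1 := widen_ord (leqnSn m).
Definition path_tgt (m : nat) : 'I_m -> 'I_m.+1 := lift ord0.

Lemma path_src_tgt (m : nat) (i : 'I_m) : path_src i != path_tgt i.
Proof. by rewrite -val_eqE /= /bump add1n neq_ltn leqnn. Qed.

Lemma loose_path_gt0 (k m : nat) : (0 < #|power_vertex k m.+1 m|)%N.
Proof. by apply/card_gt0P; exists (inl ord0). Qed.

Lemma loose_path_edges_neq0 (k m : nat) :
  finset.set0 \notin power_edges k (@path_src m) (@path_tgt m).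
Proof.
by apply/negP => /imsetP[i _ /setP/(_ (inl (path_src i)))]; rewrite !inE eqxx.
Qed.

Definition loose_path (k m : nat) : hypergraph :=
  Hypergraph (loose_path_gt0 k m) (loose_path_edges_neq0 k m).

Lemma loose_path_connected (k m : nat) : (3 <= k)%N -> (0 < m)%N ->
  connected_uniform k (loose_path k m).
Proof.
move=> k_ge3 m_gt0; split.
- exact: uniform_power k_ge3 (@path_src_tgt m) _ _.
- have adjC : symmetric (@Defs.adjacent (loose_path k m)).
    by move=> u v; apply: eq_existsb => e; rewrite [X in _ && X]andbC.
  have conC := sym_connect_sym adjC.
  have adj (i : 'I_m) (u v : loose_path k m) :
      u \in power_edge k (@path_src m) (@path_tgt m) i ->
      v \in power_edge k (@path_src m) (@path_tgt m) i -> Defs.adjacent u v.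
    move=> ui vi; apply/existsP; exists (power_edge k (@path_src m) (@path_tgt m) i).
    by rewrite ui vi imset_f.
  (* Every vertex is joined to core vertex 0: a core vertex by descent along the path, a private
     vertex through the source of its edge. *)
  suff to0 (u : loose_path k m) : connect (@Defs.adjacent (loose_path k m)) u (inl ord0).
    by move=> u v; rewrite (connect_trans (to0 u))// conC.
  have core0 (c : nat) (cm : (c < m.+1)%N) :
      connect (@Defs.adjacent (loose_path k m)) (inl (Ordinal cm)) (inl ord0).
    elim: c cm => [|c IH] cm.
      by rewrite (_ : Ordinal cm = ord0)//; exact: val_inj.
    apply: connect_trans (IH (ltnW cm)); apply: connect1.
    apply: (adj (Ordinal (cm : c < m)%N)); rewrite mem_power_edge_inl.
      by apply/orP; right; rewrite -val_eqE.
    by apply/orP; left; rewrite -val_eqE.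
  case: u => [[c cm]|[i j]]; first exact: core0.
  apply: connect_trans (core0 i (ltn_trans (ltn_ord i) (ltnSn m))); apply: connect1.
  apply: (adj i); first by rewrite mem_power_edge_inr.
  by rewrite mem_power_edge_inl -val_eqE eqxx.
- by rewrite /= (@card_power_edges k m.+1 m _ _ k_ge3).
Qed.

Section PathRadius.
Variables (R : realType) (k m : nat) (alpha h r : R).
Hypothesis k_ge3 : (3 <= k)%N.
Hypothesis alpha_ge0 : 0 <= alpha.
Hypothesis alpha_lt1 : alpha < 1.
Hypothesis h_gt0 : 0 < h.
Hypothesis hE : h ^+ 2 * (2 * h + alpha) ^+ (k - 2) = (1 - alpha) ^+ k.
Hypothesis path_r : is_alpha_spectral_radius k alpha (loose_path k m) r.

Let phi (t : R) : R := (t + 1) * (m%:R + 1 - t).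

Lemma path_profile_gt0 (d : nat) : (d < m.+1)%N -> 0 < phi d%:R.
Proof.
rewrite ltnS -(ler_nat R) => dm; apply: mulr_gt0.
  by rewrite ltr_wpDl.
by rewrite subr_gt0 (le_lt_trans dm)// ltrDl.
Qed.

(* Strict concavity of [phi] makes the weights [h phi(i+1)/phi(i)] and
   [h phi(i)/phi(i+1)] on the two core vertices of the i-th edge add up to less
   than [2h] at every core vertex; [phi] vanishes at [-1] and [m+1], the missing
   neighbours of the two ends. *)
Lemma path_weights_sum (X : 'I_m.+1 -> R) : (forall c, 0 <= X c) ->
  \sum_(i < m) ((alpha + h * (phi i.+1%:R / phi i%:R)) * X (path_src i) +
                (alpha + h / (phi i.+1%:R / phi i%:R)) * X (path_tgt i)) <=
  \sum_(c < m.+1) (2 * h + 2 * alpha - 2 * h / phi c%:R) * X c.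
Proof.
move=> X_ge0.
pose G (t : R) := alpha + h * phi (t + 1) / phi t.
pose G' (t : R) := alpha + h * phi (t - 1) / phi t.
have sumG : \sum_(i < m) (alpha + h * (phi i.+1%:R / phi i%:R)) * X (path_src i)
    <= \sum_(c < m.+1) G c%:R * X c.
  (* The last core vertex is no source; its extra term on the right is [alpha X], because [phi]
     vanishes at [m + 1]. *)
  rewrite big_ord_recr/= ler_wpDr//; last first.
    by apply: ler_sum => i _; rewrite /G natr1 mulrA.
  rewrite /G (_ : phi (m%:R + 1) = 0) ?mulr0 ?mul0r ?addr0 ?mulr_ge0//.
  by rewrite /phi subrr mulr0.
have sumG' : \sum_(i < m) (alpha + h / (phi i.+1%:R / phi i%:R)) * X (path_tgt i)
    <= \sum_(c < m.+1) G' c%:R * X c.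
  rewrite big_ord_recl/= ler_wpDl//; last first.
    apply: ler_sum => i _; rewrite /G' invf_div /bump add1n.
    by rewrite -[X in phi (X - 1)]natr1 addrK mulrA.
  rewrite /G' (_ : phi (0 - 1) = 0) ?mulr0 ?mul0r ?addr0 ?mulr_ge0//.
  by rewrite /phi sub0r addNr mul0r.
rewrite big_split/= (le_trans (lerD sumG sumG'))// -big_split/=.
apply: ler_sum => c _; rewrite -mulrDl ler_wpM2r//.
have phi_neq0 : phi c%:R != 0 by rewrite gt_eqF// path_profile_gt0.
(* The constant second difference [-2] of [phi] produces the gap [2 h / phi c]. *)
have phi2 : phi (c%:R + 1) + phi (c%:R - 1) = 2 * phi c%:R - 2.
  by rewrite /phi; ring.
rewrite /G /G' addrACA -!mulrDl -!mulrDr -mulrA phi2.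
by rewrite le_eqVlt; apply/orP; left; apply/eqP; field.
Qed.

Lemma loose_path_radius_lt : r < 2 * h + 2 * alpha.
Proof.
have k_gt1 := ltnW k_ge3; have k_gt0 := ltnW k_gt1.
have a01 : 0 <= alpha <= 1 by rewrite alpha_ge0 ltW.
have uH : uniform k (loose_path k m) :=
  @uniform_power k m.+1 m _ _ k_ge3 (@path_src_tgt m) (loose_path_gt0 k m)
    (loose_path_edges_neq0 k m).
have [s [x [Hs x_ge0 x1 xs _]]] := spectral_radius_exists uH k_gt1 a01.
move: (spectral_radius_unique path_r Hs) => ->.
pose X (c : 'I_m.+1) := x (inl c) ^+ k.
have X_ge0 c : 0 <= X c by exact: exprn_ge0.
pose P : R := \sum_(i < m) \sum_(j < k - 2) x (inr (i, j)) ^+ k.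
have P_ge0 : 0 <= P by do 2!apply: sumr_ge0 => ? _; exact: exprn_ge0.
have XP1 : \sum_c X c + P = 1.
  by rewrite -x1 (@sum_power_vertex k m.+1 m R (fun v => x v ^+ k)).
(* If the maximiser vanishes on the core, all edge products vanish and the radius is just [alpha].
   Otherwise a core vertex with [X c] nonzero makes the gap strict. *)
have [X0|/existsP[c Xc]] := altP (@forallP _ (fun c => X c == 0)).
  have x0 c : x (inl c) = 0.
    by apply/eqP; have := X0 c; rewrite /X expf_eq0 k_gt0.
  rewrite -xs (@hform_power k m.+1 m _ _ k_ge3 (@path_src_tgt m)).
  have -> : \sum_(i < m) (alpha * (x (inl (path_src i)) ^+ k +
        (x (inl (path_tgt i)) ^+ k + \sum_j x (inr (i, j)) ^+ k)) +
      (1 - alpha) * k%:R * (x (inl (path_src i)) * (x (inl (path_tgt i)) *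
        \prod_j x (inr (i, j))))) = alpha * P.
    rewrite mulr_sumr; apply: eq_bigr => i _.
    by rewrite !x0 !mul0r mulr0 addr0 expr0n gtn_eqF// !add0r.
  have -> : P = 1 by rewrite -XP1 big1 ?add0r// => c _; exact/eqP.
  by rewrite mulr1; have := h_gt0; have := alpha_ge0; lra.
have := @hform_power_le k m.+1 m _ _ k_ge3 (@path_src_tgt m) R alpha
    (loose_path_gt0 k m) (loose_path_edges_neq0 k m)
    h alpha_ge0 alpha_lt1 h_gt0 hE (fun i => phi i.+1%:R / phi i%:R) x _ x_ge0.
rewrite -[X in _ -> X <= _]/(hform k alpha x) xs => le_s.
have {le_s}/le_lt_trans : s <= \sum_(c < m.+1)
    (2 * h + 2 * alpha - 2 * h / phi c%:R) * X c + (2 * h + 2 * alpha) * P.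
  apply: le_trans (le_s _) _; last by rewrite lerD2r path_weights_sum.
  move=> i; apply: divr_gt0; apply: path_profile_gt0;
    by rewrite ltnS ?(ltnW (ltn_ord i)) ?ltn_ord.
apply; rewrite -[ltRHS]mulr1 -[X in _ < _ * X]XP1 mulrDr ltrD2r mulr_sumr.
rewrite -subr_gt0 -sumrB (bigD1 c)//=.
have gap d : (2 * h + 2 * alpha) * X d - (2 * h + 2 * alpha - 2 * h / phi d%:R) * X d
    = 2 * h / phi d%:R * X d by rewrite -mulrBl opprB addrC subrK.
rewrite ltr_wpDr//; last first.
  rewrite gap; apply: mulr_gt0; last by rewrite lt0r X_ge0 andbT; exact: Xc.
  by apply: divr_gt0; [exact: mulr_gt0|exact: path_profile_gt0].
apply: sumr_ge0 => d _; rewrite gap; apply: mulr_ge0 => //; apply: divr_ge0.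
  by rewrite mulr_ge0// ltW.
exact/ltW/path_profile_gt0.
Qed.

(** The path has one core vertex more than edges, whence the extra [h^-1], which is negligible
    against the other terms as [m] grows. *)
Lemma loose_path_radius_ge :
  m%:R * ((2 * h + 2 * alpha) * (h^-1 + (k - 2)%:R / (2 * h + alpha))) <=
  r * (m%:R * (h^-1 + (k - 2)%:R / (2 * h + alpha)) + h^-1).
Proof.
have := @power_radius_lower k m.+1 m _ _ k_ge3 (@path_src_tgt m) R alpha
    (loose_path_gt0 k m) (loose_path_edges_neq0 k m)
    h alpha_ge0 alpha_lt1 h_gt0 hE r path_r.
by move=> /le_trans; apply; rewrite -natr1 le_eqVlt; apply/orP; left; apply/eqP; ring.
Qed.

End PathRadius.

(** * Finitely many radii for bounded order *)

Section Relabelling.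
Variables (R : realType) (k : nat) (alpha : R).

(* [alpha_eigenvalue] on a bare edge set, so that it can be transported to
   ['I_n] without carrying the proofs of [hypergraph]. *)
Definition edge_eigenvalue (T : finType) (S : {set {set T}}) (lambda : R[i]) : Prop :=
  exists2 x : {ffun T -> R[i]}, x != 0 &
    forall i : T,
      (alpha%:C)%C * #|[set e in S | i \in e]|%:R * x i ^+ k.-1
      + ((1 - alpha)%:C)%C *
          (\sum_(e in S | i \in e) \prod_(j in e :\ i) x j)
      = lambda * x i ^+ k.-1.

Definition relabel (T T' : finType) (f : T -> T') (S : {set {set T}}) :
  {set {set T'}} := [set f @: (e : {set T}) | e in S].

Lemma edge_eigenvalue_relabel (T T' : finType) (f : T -> T') (g : T' -> T)
    (S : {set {set T}}) (lambda : R[i]) :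
  cancel f g -> cancel g f ->
  edge_eigenvalue S lambda -> edge_eigenvalue (relabel f S) lambda.
Proof.
move=> fK gK [x x_neq0 xE]; have f_inj := can_inj fK.
exists [ffun i => x (g i)].
  apply: contra x_neq0 => /eqP/ffunP x0; apply/eqP/ffunP => i.
  by have := x0 (f i); rewrite !ffunE fK.
move=> i'; rewrite -(gK i'); move: (g i') => i {i'}.
rewrite !ffunE fK -xE; congr (_ * _%:R * _ + _ * _).
  rewrite -[RHS](card_imset _ (imset_inj f_inj)); congr #|pred_of_set _|.
  apply/setP => e'; rewrite !inE; apply/andP/imsetP.
    move=> [/imsetP[e eS ->]]; rewrite mem_imset// => ie.
    by exists e; rewrite ?inE ?eS.
  move=> [e]; rewrite inE => /andP[eS ie] ->.
  by rewrite mem_imset// ie imset_f.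
rewrite (big_imset_cond _ _ (h := fun e : {set T} => f @: e))/=; last first.
  by move=> e e' _ _; exact: imset_inj.
apply: eq_big => [e|e _]; first by rewrite mem_imset.
have -> : f @: e :\ f i = f @: (e :\ i).
  apply/setP => j; rewrite -(gK j); move: (g j) => l.
  by rewrite !inE !mem_imset// !inE (inj_eq f_inj).
rewrite big_imset/=; last by move=> u v _ _; exact: f_inj.
by apply: eq_bigr => j _; rewrite ffunE fK.
Qed.

(** A copy on an ordinal: hypergraphs of equal order then have edge sets in one common finite
    type. *)
Definition canonical_edges (H : hypergraph) : {set {set 'I_#|H|}} :=
  relabel enum_rank (edges H).

Lemma canonical_eigenvalue (H : hypergraph) (lambda : R[i]) :
  alpha_eigenvalue k alpha H lambda <-> edge_eigenvalue (canonical_edges H) lambda.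
Proof.
split; first exact: edge_eigenvalue_relabel (@enum_rankK H) (@enum_valK H).
move/(edge_eigenvalue_relabel (@enum_valK H) (@enum_rankK H)).
rewrite (_ : relabel _ _ = edges H)//.
rewrite /canonical_edges /relabel -imset_comp -[RHS]imset_id.
apply: eq_imset => e /=; rewrite -imset_comp -[RHS]imset_id.
by apply: eq_imset => i /=; rewrite enum_rankK.
Qed.

(** Pigeonhole: an order at most [N] together with an edge set on that ordinal is an element of a
    finite type, and it determines the eigenvalues, hence the radius. *)
Lemma bounded_order_radius_collision (H : nat -> hypergraph) (r : nat -> R) (N : nat) :
    (forall i, #|H i| <= N)%N ->
    (forall i, is_alpha_spectral_radius k alpha (H i) (r i)) ->
  exists i j, i != j /\ r i = r j.
Proof.
move=> HN Hr.
pose code_type : finType := {n : 'I_N.+1 & {set {set 'I_n}}}.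
pose code i : code_type :=
  @Tagged _ (Ordinal (HN i : #|H i| < N.+1)%N) (fun n : 'I_N.+1 => {set {set 'I_n}})
    (canonical_edges (H i)).
pose eig (c : code_type) := edge_eigenvalue (tagged c).
pose g (i : 'I_#|code_type|.+1) := code i.
have [i [j [ij gij]]] : exists i j, i != j /\ g i = g j.
  apply: contrapT => noc.
  have : injective g.
    by move=> i j gij; apply/eqP/negPn/negP => ij; apply: noc; exists i, j.
  by move/leq_card; rewrite card_ord ltnn.
exists (val i), (val j); split => //; apply: spectral_radius_unique (Hr i) _.
have eigE l : alpha_eigenvalue k alpha (H i) l <-> alpha_eigenvalue k alpha (H j) l.
  by rewrite !canonical_eigenvalue -[X in X <-> _]/(eig (g i) l) gij.
have [[l lj rl] maxj] := Hr j; split; first by exists l => //; exact/eigE.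
by move=> l' /eigE /maxj.
Qed.

End Relabelling.

(** * A limit point from strict approach from below *)

Lemma limit_point_of_approach (R : realType) (k : nat) (alpha lambda : R) :
    (forall t, t < lambda -> exists H r,
       [/\ connected_uniform k H, is_alpha_spectral_radius k alpha H r &
           t < r < lambda]) ->
  is_spectral_limit_point k alpha lambda.
Proof.
move=> near_lambda.
have [f fP] : exists f : R -> hypergraph * R, forall t, t < lambda ->
    [/\ connected_uniform k (f t).1, is_alpha_spectral_radius k alpha (f t).1 (f t).2
      & t < (f t).2 < lambda].
  suff : forall t, exists p : hypergraph * R, t < lambda ->
      [/\ connected_uniform k p.1, is_alpha_spectral_radius k alpha p.1 p.2
        & t < p.2 < lambda] by move/boolp.choice => [f fP]; exists f.
  move=> t.
  (* Choice needs a value for every real [t]; above [lambda] the instance for [lambda - 1] serves as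
     default. *)
  have [/near_lambda[H [r HrP]]|le_t] := ltP t lambda; first by exists (H, r).
  have [|H [r _]] := near_lambda (lambda - 1); first by rewrite ltrBlDr ltrDl.
  by exists (H, r).
pose bound (n : nat) : R := lambda - n.+1%:R^-1.
have bound_lt n : bound n < lambda by rewrite ltrBlDr ltrDl invr_gt0.
(* Each radius exceeds its predecessor, which gives injectivity, and also [bound n], which gives
   convergence by squeezing. *)
pose u := fix u n := if n is n'.+1 then f (Num.max (u n').2 (bound n))
                     else f (bound 0).
have uP n : [/\ connected_uniform k (u n).1,
    is_alpha_spectral_radius k alpha (u n).1 (u n).2 & bound n < (u n).2 < lambda].
  elim: n => [|n [_ _ /andP[_ lt_u]]]; first exact: fP.
  have [|? ? /andP[]] := fP (Num.max (u n).2 (bound n.+1)).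
    by rewrite gt_max lt_u bound_lt.
  by rewrite gt_max => /andP[_ ?] ?; split => //; apply/andP.
have u_lt n : (u n).2 < (u n.+1).2.
  have [_ _ /andP[_ lt_u]] := uP n.
  have [|_ _ /andP[]] := fP (Num.max (u n).2 (bound n.+1)).
    by rewrite gt_max lt_u bound_lt.
  by rewrite gt_max => /andP[].
exists (fun n => (u n).1), (fun n => (u n).2); split.
- by move=> n; have [] := uP n.
- by move=> n; have [] := uP n.
- have u_mono : {homo (fun n => (u n).2) : i j / (i < j)%N >-> i < j}.
    by apply: homo_ltn => [? ? ?|//]; exact: lt_trans.
  move=> i j ij; have [/u_mono|/u_mono|//] := ltngtP i j; by rewrite ij ltxx.
- apply: (@squeeze_cvgr _ _ _ _ bound (fun=> lambda)).
  + by apply: nearW => n; have [_ _ /andP[/ltW -> /ltW ->]] := uP n.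
  + rewrite -[in X in cvg_to _ X](subr0 lambda).
    by apply: cvgB; [exact: cvg_cst|exact: cvg_harmonic].
  + exact: cvg_cst.
Qed.

(** * Balls and geodesics in a hypergraph *)

Section Geodesic.
Variable H : hypergraph.

Definition neighbourhood (v : H) : {set H} :=
  \bigcup_(e in [set e in edges H | v \in e]) e.

(** The union with [A] keeps the balls nested even at a vertex lying in no edge. *)
Definition hball (u : H) (n : nat) : {set H} :=
  iter n (fun A => A :|: \bigcup_(v in A) neighbourhood v) [set u].

Lemma hballS (u : H) n :
  hball u n.+1 = hball u n :|: \bigcup_(v in hball u n) neighbourhood v.
Proof. by []. Qed.

Lemma hball_mono (u : H) m n : (m <= n)%N -> hball u m \subset hball u n.
Proof.
move=> /subnK <-; elim: (n - m)%N => [|d IH]; first exact: subxx.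
by rewrite addSn hballS (fintype.subset_trans IH)// finset.subsetUl.
Qed.

Lemma hball_step (u v w : H) n (e : {set H}) :
  v \in hball u n -> e \in edges H -> v \in e -> w \in e -> w \in hball u n.+1.
Proof.
move=> vn eH ve we; rewrite hballS inE; apply/orP; right.
apply/finset.bigcupP; exists v => //; apply/finset.bigcupP; exists e => //.
by rewrite inE eH.
Qed.

(** A vertex lies in at most [D] edges of [k] vertices, so one step multiplies the size by at most
    [1 + D k]. *)
Lemma card_hball (k D n : nat) (u : H) :
    uniform k H -> (forall v : H, degree v <= D)%N ->
  (#|hball u n| <= (1 + D * k) ^ n)%N.
Proof.
move=> uH degD; elim: n => [|n IH]; first by rewrite cards1.
rewrite hballS (leq_trans (leq_card_setU _ _))// expnSr mulnDr muln1 leq_add//.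
rewrite (leq_trans (card_bigcup_leq _ _))//.
have Nk v : (#|neighbourhood v| <= D * k)%N.
  rewrite (leq_trans (card_bigcup_leq _ _))//.
  rewrite (eq_bigr (fun=> k)); last by move=> e; rewrite inE => /andP[/uH].
  by rewrite sum_nat_const leq_mul2r degD orbT.
rewrite (leq_trans (leq_sum _ (fun v _ => Nk v)))//.
by rewrite sum_nat_const leq_mul2r IH orbT.
Qed.

Lemma connected_hball (u w : H) : connected_hypergraph H ->
  exists n, w \in hball u n.
Proof.
move=> cH; have /connectP[p] := cH u w.
have : u \in hball u 0 by rewrite inE.
(* The start of the walk and the radius are generalised, while the centre of the ball stays
   fixed. *)
elim: p {1 3 4}u 0%N => [|v p IH] x n /= xn; first by move=> _ ->; exists n.
move=> /andP[/existsP[e /and3P[eH xe ve]]]; apply: IH.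
exact: hball_step xn eH xe ve.
Qed.

(** Built backwards: a predecessor of [w] in the ball of radius [n - 1] lies in no smaller ball,
    since otherwise [w] would be closer to [u]. *)
Lemma geodesic_exists (u w : H) (n : nat) :
    w \in hball u n -> (forall j, (j < n)%N -> w \notin hball u j) ->
  exists v : nat -> H,
    [/\ v n = w, forall i, (i <= n)%N -> v i \in hball u i,
        forall i j, (i <= n)%N -> (j < i)%N -> v i \notin hball u j &
        forall i, (i < n)%N -> Defs.adjacent (v i) (v i.+1)].
Proof.
elim: n w => [|n IH] w wn far.
  by exists (fun=> w); split=> // [[|//]|[]//].
move: (wn); rewrite hballS inE (negPf (far n _))//= => /finset.bigcupP[x xn].
move=> /finset.bigcupP[e]; rewrite inE => /andP[eH xe] we.
have [|v [vn v1 v2 v3]] := IH x xn.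
  move=> j jn; apply/negP => xj; have := far j.+1 jn.
  by rewrite (hball_step xj eH xe we).
exists (fun i => if (i <= n)%N then v i else w); rewrite ltnn; split => // i.
- rewrite leq_eqVlt ltnS => /predU1P[->|i_n]; first by rewrite ltnn.
  by rewrite i_n v1.
- move=> j; rewrite leq_eqVlt ltnS => /predU1P[->|i_n]; first by rewrite ltnn; exact: far.
  by rewrite i_n; exact: v2.
- move=> iSn; have [->|ni] := eqVneq i n; last first.
    have i_n : (i < n)%N by rewrite ltn_neqAle ni.
    by rewrite (ltnW i_n) i_n v3.
  rewrite leqnn ltnn vn; apply/existsP; exists e.
  by rewrite eH xe.
Qed.

End Geodesic.

(** * Hypergraphs of radius at most [t < lambda] have bounded order *)

Section Minimality.
Variables (R : realType) (k : nat) (alpha h : R).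
Hypothesis k_ge3 : (3 <= k)%N.
Hypothesis alpha_gt0 : 0 < alpha.
Hypothesis alpha_lt1 : alpha < 1.
Hypothesis h_gt0 : 0 < h.
Hypothesis hE : h ^+ 2 * (2 * h + alpha) ^+ (k - 2) = (1 - alpha) ^+ k.

Let lambda := 2 * h + 2 * alpha.
(** The sum of [x_v^k], for the test vector, over one core vertex and the [k - 2] other vertices of
    an edge. *)
Let c := h^-1 + (k - 2)%:R / (2 * h + alpha).
Let k_gt1 : (1 < k)%N. Proof. exact: leq_trans k_ge3. Qed.
Let alpha01 : 0 <= alpha <= 1. Proof. by rewrite !ltW. Qed.

(** The test-vector bound applies with [Z] the [n + 1] vertices of a geodesic and [F] the [n] edges
    joining consecutive ones. *)
Lemma geodesic_radius (H : hypergraph) (r : R) (u w : H) (n : nat) :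
    uniform k H -> is_alpha_spectral_radius k alpha H r ->
    w \in hball u n -> (forall j, (j < n)%N -> w \notin hball u j) ->
  n%:R * (lambda * c) <= r * (n%:R * c + h^-1).
Proof.
move=> uH Hr wn far; have [v [_ v1 v2 v3]] := geodesic_exists wn far.
have [e eP] : exists e : 'I_n -> {set H}, forall i : 'I_n,
    [/\ e i \in edges H, v i \in e i & v i.+1 \in e i].
  have adj (i : 'I_n) : exists f : {set H},
      [/\ f \in edges H, v i \in f & v i.+1 \in f].
    by have /existsP[f /and3P[]] := v3 i (ltn_ord i); exists f.
  by have [e eP] := boolp.choice adj; exists e.
(* A third geodesic vertex on an edge would give a shortcut from [u], so the edge meets the geodesic
   exactly twice. *)
have v_e (i : 'I_n) j : (j <= n)%N -> v j \in e i -> j = i \/ j = i.+1.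
  move=> jn vj; have [eH vi viS] := eP i.
  have le_j : (j <= i.+1)%N.
    rewrite leqNgt; apply/negP => ij.
    by have := v2 j i.+1 jn ij; rewrite (hball_step (v1 i (ltnW (ltn_ord i))) eH vi vj).
  have le_i : (i <= j)%N.
    rewrite leqNgt; apply/negP => ji.
    by have := v2 i.+1 j.+1 (ltn_ord i) ji; rewrite (hball_step (v1 j jn) eH vj viS).
  move: le_j; rewrite leq_eqVlt ltnS => /predU1P[->|le_ji]; first by right.
  by left; apply/eqP; rewrite eqn_leq le_ji.
have v_inj i j : (i <= n)%N -> (j <= n)%N -> v i = v j -> i = j.
  move=> i_n jn vij; have [ij|ij|//] := ltngtP i j.
    by have := v2 j i jn ij; rewrite -vij v1.
  by have := v2 i j i_n ij; rewrite vij v1.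
have e_inj : injective e.
  move=> i j eij; apply: val_inj => /=.
  have [_ vi _] := eP i; have [_ vj _] := eP j.
  have := v_e j i (ltnW (ltn_ord i)); rewrite -eij => /(_ vi).
  have := v_e i j (ltnW (ltn_ord j)); rewrite eij => /(_ vj).
  case=> [->//|ji] [//|ij].
  by have := leqnn i; rewrite {1}ij ji ltnNge leqnSn.
pose Z := [set v i | i : 'I_n.+1].
pose F := [set e i | i : 'I_n].
have cardZ : #|Z| = n.+1.
  rewrite card_imset ?card_ord// => i j /v_inj ij; apply: val_inj.
  by apply: ij; rewrite -ltnS ltn_ord.
have cardF : #|F| = n by rewrite card_imset ?card_ord.
have FZ f : f \in F -> #|f :&: Z| = 2%N.
  move=> /imsetP[i _ ->{f}]; have [eH vi viS] := eP i.
  rewrite (_ : _ :&: _ = [set v i; v i.+1]).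
    rewrite cards2 (_ : v i != v i.+1)//; apply/eqP => /v_inj.
    by move=> /(_ (ltnW (ltn_ord i)) (ltn_ord i))/eqP; rewrite ltn_eqF.
  apply/setP => x; rewrite !inE; apply/andP/orP.
    move=> [xe /imsetP[j _ xj]]; move: xe; rewrite xj => /v_e.
    by rewrite -ltnS ltn_ord => /(_ isT)[->|->]; rewrite eqxx; [left|right].
  move=> [/eqP ->|/eqP ->]; split => //; apply/imsetP.
    by exists (widen_ord (leqnSn n) i).
  by exists (lift ord0 i).
have FE : F \subset edges H.
  by apply/fintype.subsetP => _ /imsetP[i _ ->]; have [] := eP i.
have := radius_lower_bound k_ge3 (ltW alpha_gt0) alpha_lt1 h_gt0 hE uH Hr FE FZ.
rewrite cardZ cardF -/lambda -/c => /le_trans; apply.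
by rewrite -natr1 /c le_eqVlt; apply/orP; left; apply/eqP; ring.
Qed.

(** The test vector is the indicator of [v]. *)
Lemma degree_le_radius (H : hypergraph) (r : R) (v : H) :
    uniform k H -> is_alpha_spectral_radius k alpha H r ->
  alpha * (degree v)%:R <= r.
Proof.
move=> uH Hr; pose x (w : H) : R := (w == v)%:R.
have x_ge0 w : 0 <= x w by exact: ler0n.
have := hform_le_radius uH k_gt1 alpha01 Hr x_ge0.
rewrite (hform_linkE _ _ uH (ltnW k_gt1)) (bigD1 v)//= big1 ?addr0; last first.
  by move=> w /negPf wv; rewrite /x wv mul0r.
rewrite [X in r * X](bigD1 v)//= [X in r * (_ + X)]big1 ?addr0; last first.
  by move=> w /negPf wv; rewrite /x wv expr0n gtn_eqF// ltnW.
rewrite /x eqxx !expr1n mul1r !mulr1; apply: le_trans; rewrite lerDl.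
rewrite mulr_ge0 ?subr_ge0 ?(ltW alpha_lt1)// sumr_ge0// => e _.
exact: prodr_ge0.
Qed.

Lemma edge_mass_gt0 : 0 < c.
Proof.
have b_gt0 : 0 < 2 * h + alpha by rewrite addr_gt0// mulr_gt0.
by rewrite ltr_wpDr ?invr_gt0// divr_ge0// ltW.
Qed.

(** If [r <= t], the inequality yields [n c (lambda - t) <= t / h], which fails for large [n] by the
    Archimedean property. *)
Lemma long_radius (t : R) : t < lambda -> exists L : nat, forall n r, (L <= n)%N ->
  n%:R * (lambda * c) <= r * (n%:R * c + h^-1) -> t < r.
Proof.
move=> t_lt; have gap : 0 < c * (lambda - t).
  by rewrite mulr_gt0 ?edge_mass_gt0// subr_gt0.
have [L Lt] : exists L : nat, t / h / (c * (lambda - t)) < L%:R.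
  exists (Num.bound `|t / h / (c * (lambda - t))|).
  by rewrite (le_lt_trans (ler_norm _))// archi_boundP ?normr_ge0.
exists L => n r Ln le_nr; rewrite ltNge; apply/negP => le_rt.
have {Lt} : t / h / (c * (lambda - t)) < n%:R by rewrite (lt_le_trans Lt)// ler_nat.
rewrite ltr_pdivrMr// ltNge => /negP; apply.
have : r * (n%:R * c + h^-1) <= t * (n%:R * c + h^-1).
  by rewrite ler_wpM2r// addr_ge0 ?mulr_ge0 ?invr_ge0// ltW// edge_mass_gt0.
move: le_nr; set N := n%:R; set H := h^-1; set C := c; set l := lambda => *.
by lra.
Qed.

Lemma bounded_radius_order (t : R) : t < lambda -> exists N : nat,
  forall (H : hypergraph) (r : R), connected_uniform k H ->
    is_alpha_spectral_radius k alpha H r -> r <= t -> (#|H| <= N)%N.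
Proof.
move=> /long_radius[L LP]; pose D := Num.bound `|t / alpha|.
exists ((1 + D * k) ^ L)%N => H r [uH cH _] Hr rt; rewrite leqNgt; apply/negP => big.
have degD (v : H) : (degree v <= D)%N.
  rewrite -(ler_nat R) ltW//; apply: (@le_lt_trans _ _ (t / alpha)).
    by rewrite ler_pdivlMr// mulrC (le_trans _ rt)// degree_le_radius.
  by rewrite (le_lt_trans (ler_norm _))// archi_boundP ?normr_ge0.
have /card_gt0P[u _] := vertex_gt0 H.
(* A ball of radius [L] is too small to contain all vertices, so some vertex lies outside it. *)
have [w wL] : exists w, w \notin hball u L.
  apply/existsP; rewrite -negb_forall; apply: contraL big => /forallP uL.
  rewrite -leqNgt (leq_trans _ (card_hball L u uH degD))//.
  by apply/subset_leq_card/fintype.subsetP => v _; exact: uL.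
have [n0 wn0] := connected_hball u w cH.
(* The least such radius is the distance from [u] to [w]; it is at least [L], so the geodesic forces
   [r > t]. *)
case: (ex_minnP (ex_intro (fun n => w \in hball u n) n0 wn0)) => n wn nmin.
have Ln : (L <= n)%N.
  rewrite leqNgt; apply: contra wL => nL.
  exact: (fintype.subsetP (hball_mono u (ltnW nL))).
have := LP n r Ln (geodesic_radius uH Hr wn _); rewrite ltNge rt => /(_ _)/negP.
by apply => // j jn; apply/negP => /nmin; rewrite leqNgt jn.
Qed.

End Minimality.

(** * Attainment of the limit and its minimality *)

Theorem theorem1p1 (R : realType) (k : nat) (alpha : R)
    (k_ge3 : (3 <= k)%N) (alpha_gt0 : 0 < alpha) (alpha_lt1 : alpha < 1) :
  exists2 lambda : R, is_lambda k alpha lambda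
    & is_smallest_spectral_limit_point k alpha lambda.
Proof.
have a_ge0 := ltW alpha_gt0.
have k_gt1 := ltnW k_ge3.
have a01 : 0 <= alpha <= 1 by rewrite a_ge0 ltW.
have [|h h_gt0 hE] := @exists_half_gap R k alpha; first by rewrite a_ge0.
exists (2 * h + 2 * alpha); first exact: loose_cycle_radius.
split.
  apply: limit_point_of_approach => t /(long_radius k alpha_gt0 h_gt0)[L LP].
  (* The path has [L + 1] edges, so that it has an edge even when [L] is 0. *)
  have cP := loose_path_connected k_ge3 (ltn0Sn L).
  have [uP _ _] := cP.
  have [r [x [Hr _ _ _ _]]] := spectral_radius_exists uP k_gt1 a01.
  exists (loose_path k L.+1), r; split => //; apply/andP; split.
    exact: LP (leqnSn L) (loose_path_radius_ge k_ge3 a_ge0 alpha_lt1 h_gt0 hE Hr).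
  exact: loose_path_radius_lt k_ge3 a_ge0 alpha_lt1 h_gt0 hE Hr.
move=> nu [H [r [cH Hr r_inj r_nu]]]; rewrite leNgt; apply/negP => nu_lt.
(* Any [t] strictly between [nu] and [lambda] would do: a tail of the radii stays below [t], so its
   hypergraphs have bounded order and two radii coincide, against injectivity. *)
pose t := (nu + (2 * h + 2 * alpha)) / 2.
have nu_t : nu < t by rewrite /t; lra.
have t_lt : t < 2 * h + 2 * alpha by rewrite /t; lra.
have [N NP] := bounded_radius_order k_ge3 alpha_gt0 alpha_lt1 h_gt0 hE t_lt.
have [i0 _ rt] : (\forall n \near \oo, r n < t)%classic by exact: (cvgr_lt nu r_nu).
have [||i [j [ij rij]]] := @bounded_order_radius_collision R k alpha
  (fun i => H (i + i0)%N) (fun i => r (i + i0)%N) N.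
- by move=> i; apply: NP (cH _) (Hr _) (ltW (rt _ _)); rewrite /= leq_addl.
- by move=> i; exact: Hr.
by move: ij; move/r_inj: rij => /addIn ->; rewrite eqxx.
Qed.
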